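(* Let $I$ be a non-empty subset of $\mathbb{N}$ and let $S$ be an ideal extension of $\mathbb{N}^{(I)}$ with more than one extreme ray (that is, $|\mathcal{E}(S)|>1$). Then $$\omega(S)\ge\sup\{2\lVert\mathbf{r}\rVert_1-1:\mathbf{r}\in\mathcal{E}(S)\}.$$
   Context: $\mathbb{N}$ is the set of non-negative integers. For a non-empty set $I\subseteq\mathbb{N}$, $\mathbb{N}^{(I)}$ is the additive monoid (componentwise addition) of all sequences $(n_i)_{i\in I}$ of non-negative integers with $n_i=0$ for all but finitely many $i$; $\mathbf{0}$ is the zero sequence, $\lVert\mathbf{a}\rVert_1=\sum_{i\in I}a_i$ and $\operatorname{Supp}(\mathbf{a})=\{i\in I:a_i\ne 0\}$ for $\mathbf{a}=(a_i)_{i\in I}$; $\le$ is the componentwise partial order. A subset $E\subseteq\mathbb{N}^{(I)}$ is an ideal if $E+\mathbb{N}^{(I)}\subseteq E$; a submonoid $S$ is an ideal extension of $\mathbb{N}^{(I)}$ if $S=E\cup\{\mathbf{0}\}$ for some ideal $E$ of $\mathbb{N}^{(I)}$. Put $S^*=S\setminus\{\mathbf{0}\}$; $\mathcal{M}(S)$ is the set of $\le$-minimal elements of $S^*$; $\mathcal{A}(S)=S^*\setminus(S^*+S^* )$ is the set of atoms; the set of extreme rays of $S$ is $\mathcal{E}(S)=\{\mathbf{m}\in\mathcal{M}(S):|\operatorname{Supp}(\mathbf{m})|=1\}$. Write $\mathbf{a}\le_S\mathbf{b}$ if $\mathbf{b}-\mathbf{a}\in S$. For $\mathbf{s}\in S$,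 the $\omega$-primality $\omega(\mathbf{s})$ is the least positive integer $N$ such that whenever $\mathbf{s}\le_S\mathbf{s}_1+\cdots+\mathbf{s}_n$ with $\mathbf{s}_1,\dots,\mathbf{s}_n\in S$, there is $J\subseteq\{1,\dots,n\}$ with $|J|\le N$ and $\mathbf{s}\le_S\sum_{j\in J}\mathbf{s}_j$ ($\omega(\mathbf{s})=\infty$ if there is no such $N$). Finally $\omega(S)=\sup\{\omega(\mathbf{a}):\mathbf{a}\in\mathcal{A}(S)\}$; suprema are taken in $\mathbb{N}\cup\{\infty\}$. *)

(* Defs.v *)
From HB Require Import structures.
From mathcomp Require Import all_boot all_order all_algebra.
From mathcomp Require Import finmap.
From mathcomp Require Import mathcomp_extra boolp classical_sets functions cardinality.
Set Implicit Arguments.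
Unset Strict Implicit.
Unset Printing Implicit Defensive.
Import Order.TTheory GRing.Theory.
Local Open Scope classical_set_scope.
Local Open Scope ring_scope.

(* N u {oo} *)
Variant enat : Type := Fin of nat | Infty.

Definition option_of_enat (x : enat) : option nat :=
  if x is Fin n then Some n else None.
Definition enat_of_option (o : option nat) : enat :=
  if o is Some n then Fin n else Infty.
Lemma option_of_enatK : cancel option_of_enat enat_of_option.
Proof. by case. Qed.

HB.instance Definition _ := Choice.copy enat (can_type option_of_enatK).

Definition le_enat (x y : enat) : bool :=
  match x, y with
  | _, Infty => true
  | Infty, Fin _ => false
  | Fin m, Fin n => (m <= n)%N
  end.

Lemma le_enat_refl : reflexive le_enat.
Proof. by case=> //= n. Qed.
Lemma le_enat_anti : antisymmetric le_enat.
Proof. by move=> [m|] [n|] //= /anti_leq ->. Qed.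
Lemma le_enat_trans : transitive le_enat.
Proof. by move=> [m|] [n|] [p|] //=; apply: leq_trans. Qed.

HB.instance Definition _ := Order.Le_isPOrder.Build Order.default_display enat
  le_enat_refl le_enat_anti le_enat_trans.

Definition enat_least (P : nat -> Prop) : enat :=
  if pselect (exists n, `[< P n >]) is left exP then Fin (ex_minn exP)
  else Infty.

(* enat_supP shows that this is the least upper bound in enat; the supremum of
   the empty set is Fin 0. *)
Definition enat_sup (A : set enat) : enat :=
  enat_least (fun n => ubound A (Fin n)).

Lemma enat_leastP (P : nat -> Prop) (n : nat) :
  enat_least P = Fin n <-> P n /\ forall m, P m -> (n <= m)%N.
Proof.
rewrite /enat_least; case: pselect => [exP|nexP]; last first.
  by split=> // -[Pn _]; case: nexP; exists n; apply/asboolP.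
case: ex_minnP => m /asboolP Pm minm; split=> [|[Pn minn]].
  by case=> <-; split=> // k Pk; apply/minm/asboolP.
congr Fin; apply/anti_leq; rewrite (minn _ Pm) andbT.
exact/minm/asboolP.
Qed.

Lemma enat_least_infty (P : nat -> Prop) :
  enat_least P = Infty <-> forall n, ~ P n.
Proof.
rewrite /enat_least; case: pselect => [exP|nexP]; split=> //.
  by move=> nP; have [n /asboolP/nP] := exP.
move=> _ n Pn; by apply: nexP; exists n; apply/asboolP.
Qed.

Lemma enat_supP (A : set enat) (y : enat) :
  (enat_sup A <= y)%O <-> ubound A y.
Proof.
case E: (enat_sup A) => [m|].
  have [ubA minA] := (enat_leastP _ _).1 E.
  split=> [lemy x Ax|]; first exact: le_trans (ubA x Ax) lemy.
  by case: y => // n ubn; apply: minA.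
have nub := (enat_least_infty _).1 E.
case: y => [n|]; split=> //; first by move=> /nub.
by move=> _ [].
Qed.

(* The monoid N^(I); I coerces to the subtype {i : nat | i \in I}. *)
Definition finseq (I : set nat) : Type := {fsfun I -> nat with 0%N}.

Section FinSeq.
Variable I : set nat.
Implicit Types a b c : {fsfun I -> nat with 0%N}.

Definition finseq0 : {fsfun I -> nat with 0%N} := [fsfun].
Definition finseq_add a b : {fsfun I -> nat with 0%N} :=
  [fsfun i in (finsupp a `|` finsupp b)%fset => (a i + b i)%N].

Lemma finseq0E i : finseq0 i = 0%N.
Proof. by rewrite fsfun_dflt // finsupp0. Qed.

Lemma finseq_addE a b i : finseq_add a b i = (a i + b i)%N.
Proof.
rewrite fsfun_fun in_fsetU.
by case: (finsuppP a i); case: (finsuppP b i).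
Qed.

Lemma finseq_addA : associative finseq_add.
Proof. by move=> a b c; apply/fsfunP => i; rewrite !finseq_addE addnA. Qed.
Lemma finseq_addC : commutative finseq_add.
Proof. by move=> a b; apply/fsfunP => i; rewrite !finseq_addE addnC. Qed.
Lemma finseq_add0 : left_id finseq0 finseq_add.
Proof. by move=> a; apply/fsfunP => i; rewrite finseq_addE finseq0E. Qed.

HB.instance Definition _ := Choice.on (finseq I).
HB.instance Definition _ := GRing.isNmodule.Build (finseq I)
  finseq_addA finseq_addC finseq_add0.

Lemma finseq0_coord (i : I) : (0 : finseq I) i = 0%N.
Proof. exact: finseq0E. Qed.
Lemma finseqD_coord (x y : finseq I) (i : I) : (x + y) i = (x i + y i)%N.
Proof. exact: finseq_addE. Qed.

Definition coord_le (x y : finseq I) : Prop := forall i : I, (x i <= y i)%N.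

Definition Supp (x : finseq I) : {fset I} := finsupp x.

Definition norm1 (x : finseq I) : nat := (\sum_(i <- Supp x) x i)%N.

End FinSeq.

Section Monoid.
Variable V : nmodType.
Implicit Types (S E A B : set V).

Definition sumset A B : set V := [set a + b | a in A & b in B].

Definition is_submonoid S : Prop := S 0 /\ sumset S S `<=` S.

Definition is_ideal E : Prop := sumset E setT `<=` E.

Definition is_ideal_extension S : Prop :=
  is_submonoid S /\ exists2 E : set V, is_ideal E & S = E `|` [set 0].

Definition nonzero S : set V := S `\ 0.

Definition atoms S : set V := nonzero S `\` sumset (nonzero S) (nonzero S).

(* b - a \in S: V has no subtraction, but c is unique when V is cancellative,
   as N^(I) is. *)
Definition le_in S (a b : V) : Prop := exists2 c, S c & b = a + c.

Definition omega_bound S (s : V) (N : nat) : Prop :=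
  forall (n : nat) (t : 'I_n -> V), (forall i, S (t i)) ->
    le_in S s (\sum_(i < n) t i) ->
    exists J : {set 'I_n}, (#|J| <= N)%N /\ le_in S s (\sum_(j in J) t j).

Definition omega_elt S (s : V) : enat :=
  enat_least (fun N => (0 < N)%N /\ omega_bound S s N).

Definition omega S : enat := enat_sup [set omega_elt S a | a in atoms S].

End Monoid.

Section ExtremeRays.
Variable I : set nat.
Implicit Types S : set (finseq I).

Definition minimal_elts S : set (finseq I) :=
  [set m | nonzero S m /\ forall x, nonzero S x -> coord_le x m -> x = m].

Definition extreme_rays S : set (finseq I) :=
  [set m | minimal_elts S m /\ #|` Supp m| = 1%N].

End ExtremeRays.

(* Main.v *)
(* If r = a e_i and r' = b e_j are distinct extreme rays, then i <> j. The
   element s = (2a-1) e_i is an atom, since every nonzero element of S on the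
   i-th axis has i-th coordinate at least a. It divides the sum of 2a-1 copies
   of t = b e_j + e_i, with quotient (2a-1) r', but the sum of fewer copies of t
   has too small an i-th coordinate; hence omega(s) >= 2a-1. *)
Require Import Defs.
From HB Require Import structures.
From mathcomp Require Import all_boot all_order all_algebra.
From mathcomp Require Import finmap.
From mathcomp Require Import mathcomp_extra boolp classical_sets functions cardinality.
Local Open Scope classical_set_scope.

(** If nothing satisfies [P], the least value is [Infty], so an infinite omega-primality needs no
    separate treatment. *)
Lemma le_enat_least (P : nat -> Prop) (n : nat) :
  (forall m, P m -> (n <= m)%N) -> (Fin n <= enat_least P)%O.
Proof.
move=> nP; case E: (enat_least P) => [m|//].
by have [/nP] := (enat_leastP _ _).1 E.
Qed.

(** Quantified over [x], this is [ubound A (enat_sup A)], which [enat_supP] reduces to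
    reflexivity. *)
Lemma le_enat_sup (A : set enat) (x : enat) : A x -> (x <= enat_sup A)%O.
Proof. by move: x; apply/enat_supP; exact: Order.POrderTheory.lexx. Qed.

Section IdealExtensions.
Import GRing.Theory.
Local Open Scope ring_scope.
Context {V : nmodType} (S : set V).

Lemma submonoidMn (x : V) (n : nat) : is_submonoid S -> S x -> S (x *+ n).
Proof.
move=> [S0 SD] Sx; elim: n => [|n IHn]; first by rewrite mulr0n.
by rewrite mulrS; apply: SD; exists x => //; exists (x *+ n).
Qed.

(** A nonzero [x] lies in the ideal, which absorbs every [y] of [V]. This matters for
    [y = basis_vec i], which need not belong to [S]. *)
Lemma ideal_extensionD (x y : V) :
  is_ideal_extension S -> nonzero S x -> S (x + y).
Proof.
move=> [_ [E Eideal ->]] [[Ex|//] _].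
by left; apply: Eideal; exists x => //; exists y.
Qed.

End IdealExtensions.

Section FiniteSequences.
Import GRing.Theory.
Local Open Scope ring_scope.
Context {I : set nat}.

Lemma finseqMn_coord (x : finseq I) (n : nat) (i : I) :
  (x *+ n) i = (x i * n)%N.
Proof.
elim: n => [|n IHn]; first by rewrite mulr0n finseq0_coord muln0.
by rewrite mulrS finseqD_coord IHn mulnS.
Qed.

Definition basis_vec (i : I) : finseq I := [fsfun x in [fset i]%fset => 1%N].

Lemma basis_vecE (i k : I) : basis_vec i k = (k == i).
Proof. by rewrite fsfun_fun in_fset1; case: eqP. Qed.

Lemma Supp_singleP (m : finseq I) : #|` Supp m| = 1%N ->
  exists i : I, (0 < norm1 m)%N /\ m = basis_vec i *+ norm1 m.
Proof.
move/eqP/cardfs1P => [i mi]; exists i.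
have nm : norm1 m = m i by rewrite /norm1 mi big_seq_fset1.
have mi0 : m i != 0%N by rewrite -mem_finsupp -/(Supp m) mi in_fset1.
split; first by rewrite nm lt0n.
apply/fsfunP => k; rewrite finseqMn_coord basis_vecE nm.
have [->|ki] := eqVneq k i; first by rewrite mul1n.
by rewrite mul0n fsfun_dflt // -/(Supp m) mi in_fset1.
Qed.

End FiniteSequences.

Section ExtremeRayBound.
Import GRing.Theory.
Local Open Scope ring_scope.
Context {I : set nat} {S : set (finseq I)}.
Hypothesis hS : is_ideal_extension S.

(** The order is total on an axis, so two minimal elements there are comparable. *)
Lemma minimal_axis_inj (i : I) (a b : nat) :
  minimal_elts S (basis_vec i *+ a) -> minimal_elts S (basis_vec i *+ b) ->
  basis_vec i *+ a = basis_vec i *+ b.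
Proof.
move=> [Sa mina] [Sb minb]; have [le_ab|/ltnW le_ba] := leqP a b.
  by apply: minb => // k; rewrite !finseqMn_coord leq_mul.
by apply/esym/mina => // k; rewrite !finseqMn_coord leq_mul.
Qed.

Lemma minimal_axis_atom (i : I) (a : nat) : (0 < a)%N ->
  minimal_elts S (basis_vec i *+ a) -> atoms S (basis_vec i *+ (2 * a - 1)).
Proof.
move=> a_gt0 [Sr minr].
(* This split exhibits $(2a-1)e_i$ as the ray $a e_i$ plus a vector, hence as an element of [S]. *)
have nat_split : (2 * a - 1 = a + (a - 1))%N by rewrite mul2n -addnn addnBA.
(* Off the axis the sum vanishes, hence so does [x]. If moreover $x_i < a$, then $x \le a e_i$, and
   minimality forces $x = a e_i$, contradicting $x_i < a$. *)
have small (x y : finseq I) : nonzero S x ->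
    basis_vec i *+ (2 * a - 1) = x + y -> (a <= x i)%N.
  move=> Sx sxy; have [//|lt_xa] := leqP a (x i).
  suff xr : x = basis_vec i *+ a.
    by rewrite xr finseqMn_coord basis_vecE eqxx mul1n ltnn in lt_xa.
  apply: minr => // k; have [->|ki] := eqVneq k i.
    by rewrite finseqMn_coord basis_vecE eqxx mul1n ltnW.
  have /eqP := congr1 (fun z : finseq I => z k) sxy.
  rewrite finseqMn_coord basis_vecE (negbTE ki) mul0n finseqD_coord.
  by rewrite eq_sym addn_eq0 => /andP[/eqP->].
split; first split.
- by rewrite nat_split mulrnDr; apply: ideal_extensionD.
- move=> /(congr1 (fun z : finseq I => z i)) /eqP.
  rewrite finseqMn_coord basis_vecE eqxx mul1n finseq0_coord nat_split.
  by rewrite addn_eq0 -leqn0 leqNgt a_gt0.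
- move=> [x Sx [y Sy xy]].
  have ax := small x y Sx (esym xy).
  have ay : (a <= y i)%N by apply: (small y x) => //; rewrite addrC xy.
  (* The two summands together give at least $2a$ at [i], but the sum has only $2a-1$ there. *)
  have := leq_add ax ay; rewrite -finseqD_coord xy finseqMn_coord.
  rewrite basis_vecE eqxx mul1n addnn -mul2n leqNgt -subn_gt0.
  by rewrite subKn ?muln_gt0.
Qed.

Lemma omega_bound_axis (i : I) (r' : finseq I) (n N : nat) :
  nonzero S r' -> r' i = 0%N -> omega_bound S (basis_vec i *+ n) N -> (n <= N)%N.
Proof.
move=> Sr' r'i /(_ n (fun=> r' + basis_vec i)) [].
- by move=> _; apply: ideal_extensionD.
- exists (r' *+ n); last by rewrite sumr_const card_ord mulrnDl addrC.
  by apply: submonoidMn; [case: hS | case: Sr'].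
(* As [r' i = 0], each copy of [r' + basis_vec i] contributes exactly 1 at [i], so
   [#|J| = n + c i]. *)
move=> J [JN [c _ /(congr1 (fun z : finseq I => z i))]].
rewrite sumr_const finseqD_coord !finseqMn_coord finseqD_coord r'i.
rewrite basis_vecE eqxx !mul1n => Jn.
by apply: leq_trans JN; rewrite Jn leq_addr.
Qed.

Lemma omega_ge_extreme_ray (r r' : finseq I) :
  extreme_rays S r -> extreme_rays S r' -> r != r' ->
  (Fin (2 * norm1 r - 1)%N <= omega S)%O.
Proof.
move=> [rmin /Supp_singleP[i [a_gt0 ra]]] [rmin' /Supp_singleP[j [_ rb]]] rr'.
have ij : i != j.
  apply: contra_neq rr' => ij; rewrite ra rb ij.
  by apply: minimal_axis_inj; rewrite -?rb // -ij -ra.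
apply: (@Order.POrderTheory.le_trans _ _
  (omega_elt S (basis_vec i *+ (2 * norm1 r - 1)))); last first.
  apply: le_enat_sup; eexists; last by [].
  by apply: minimal_axis_atom => //; rewrite -ra.
apply: le_enat_least => N [_]; apply: (@omega_bound_axis _ r').
  by case: rmin'.
by rewrite rb finseqMn_coord basis_vecE (negbTE ij).
Qed.

End ExtremeRayBound.

(** Otherwise [A] would be contained in the singleton of [x], and two points would inject into
    one. *)
Lemma card_ge2_neq {T : choiceType} (A : set T) (x : T) :
  (`I_2 #<= A)%card -> exists2 y, A y & x != y.
Proof.
move=> A2; apply: contrapT => noy.
suff : (`I_2 #<= `I_1)%card by rewrite card_le_II.
rewrite -(card_le_eqr (card_set1 (x := x))); apply: card_le_trans A2 _.
apply: subset_card_le => y Ay; apply: contrapT => yx.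
by apply: noy; exists y => //; apply/eqP => xy; apply: yx.
Qed.

(* The subtraction is truncated, but norm1 r is positive for every extreme
   ray r. *)
Theorem corollary6p9 (I : set nat) (hI : I !=set0) (S : set (finseq I))
    (hS : is_ideal_extension S) (hE : (`I_2 #<= extreme_rays S)%card) :
  (enat_sup [set Fin (2 * norm1 r - 1)%N | r in extreme_rays S] <= omega S)%O.
Proof.
apply/enat_supP => _ [r Er <-].
have [r' Er' rr'] := card_ge2_neq _ r hE.
exact: (omega_ge_extreme_ray hS r r').
Qed.
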